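(* Let $n\ge 0$ and $k>0$ be integers. Then $$(-1)^{k-1}\left(\rho_{6}(n)-\sum_{j=-k}^k (-1)^j\,b_6\!\left(n-\frac{j(3j-1)}{2}\right)\right)\ge 0,$$ with strict inequality if $n\ge (k+1)(3(k+1)-1)/2$.
   Context: A partition of $n$ is a non-increasing sequence of positive integers (parts) with sum $n$; the empty partition is the only partition of $0$. $b_6(n)$ denotes the number of $6$-regular partitions of $n$, i.e. partitions of $n$ with no part divisible by $6$, with the convention $b_6(x)=0$ if $x$ is not a non-negative integer. For a positive integer $R$, $\rho_R(n):=(-1)^i$ if $n=Ri(3i-1)/2$ for some $i\in\mathbb Z$, and $\rho_R(n):=0$ otherwise. *)

(* Defs.v *)
From mathcomp Require Import all_boot all_order all_algebra.
From mathcomp Require Import zify.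

Set Implicit Arguments.
Unset Strict Implicit.
Unset Printing Implicit Defensive.
Import Order.TTheory GRing.Theory Num.Theory.

Local Open Scope ring_scope.

Definition is_partition (n : nat) (s : seq nat) : bool :=
  [&& sorted geq s, all (leq 1) s & sumn s == n].

Definition regular (l : nat) (s : seq nat) : bool :=
  all (fun p => ~~ (l %| p)%N) s.

(* A partition of n has at most n parts, each at most n, so nothing is lost by
   counting inside the finite type of such sequences; see num_regular_unique. *)
Definition num_regular (l n : nat) : nat :=
  #|[set s : n.-bseq 'I_n.+1 |
      let t := [seq val i | i <- s] in is_partition n t && regular l t]|.

Definition b (l : nat) (x : int) : int :=
  if x is Posz n then (num_regular l n)%:Z else 0.

(* The division is exact; see mul2_pent. *)
Definition pent (i : int) : int := ((i * (3 * i - 1)) %/ 2)%Z.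

(* The integers -k, ..., k. *)
Definition symrange (k : nat) : seq int :=
  [seq i%:Z - k%:Z | i <- iota 0 k.*2.+1].

(* For 0 < R, any i with n = R * pent i satisfies |i| <= n and is unique;
   see rho_pent and rho_eq0. *)
Definition rho (R n : nat) : int :=
  if [seq i <- symrange n | n%:Z == R%:Z * pent i] is i :: _
  then (-1) ^ i else 0.

Lemma mul2_pent (i : int) : 2 * pent i = i * (3 * i - 1).
Proof.
rewrite /pent mulrC divzK //.
have [m [->|->]] : exists m : int, i = 2 * m \/ i = 2 * m + 1.
- exists (i %/ 2)%Z; lia.
- by rewrite -mulrA dvdz_mulr.
- have -> : 3 * (2 * m + 1) - 1 = 2 * (3 * m + 1) :> int by lia.
  by rewrite mulrCA dvdz_mulr.
Qed.

Lemma mem_symrange (k : nat) (j : int) :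
  (j \in symrange k) = (- k%:Z <= j <= k%:Z).
Proof.
apply/mapP/idP => [[i]|jk].
  rewrite mem_iota => ik ->; lia.
exists (absz (j + k%:Z)); last lia.
by rewrite mem_iota; lia.
Qed.

Lemma symrange_uniq (k : nat) : uniq (symrange k).
Proof. by rewrite map_inj_uniq ?iota_uniq // => i j; lia. Qed.

Lemma pent_inj : injective pent.
Proof.
move=> i j /(congr1 ( *%R 2)); rewrite !mul2_pent => eq_ij.
have /eqP : (i - j) * (3 * (i + j) - 1) = 0 by nia.
rewrite mulf_eq0 => /orP[/eqP|/eqP]; lia.
Qed.

Lemma rho_pent (R n : nat) (i : int) :
  (0 < R)%N -> n%:Z = R%:Z * pent i -> rho R n = (-1) ^ i.
Proof.
move=> R_gt0 def_n; rewrite /rho.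
set s := [seq _ <- _ | _].
have s_i : i \in s.
  rewrite mem_filter mem_symrange; apply/andP; split; first exact/eqP.
  have i_le : i <= pent i by have := mul2_pent i; nia.
  have Ni_le : - i <= pent i by have := mul2_pent i; nia.
  have : pent i <= n%:Z by rewrite def_n; nia.
  lia.
have : forall j, j \in s -> j = i.
  move=> j; rewrite mem_filter def_n => /andP[/eqP + _].
  by move/(mulfI (_ : R%:Z != 0)) => /(_ ltac:(lia)) /pent_inj.
by case: s s_i => // j s _ /(_ j (mem_head _ _)) ->.
Qed.

Lemma rho_eq0 (R n : nat) :
  (forall i : int, n%:Z <> R%:Z * pent i) -> rho R n = 0.
Proof.
move=> no_i; rewrite /rho.
case def_s: [seq _ <- _ | _] => [//|i s].
have : i \in i :: s by rewrite mem_head.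
by rewrite -def_s mem_filter => /andP[/eqP /no_i].
Qed.

Lemma num_regular_unique (l n : nat) (ps : seq (seq nat)) :
  uniq ps -> (forall s, (s \in ps) = is_partition n s && regular l s) ->
  num_regular l n = size ps.
Proof.
move=> ps_uniq ps_mem; rewrite /num_regular cardE.
set A := [set _ | _].
pose f (s : n.-bseq 'I_n.+1) : seq nat := [seq val i | i <- s].
have f_inj : injective f.
  by move=> s t /(inj_map val_inj) /val_inj.
rewrite -(size_map f); apply/perm_size/uniq_perm => //.
  by rewrite map_inj_uniq ?enum_uniq.
move=> t; rewrite ps_mem; apply/mapP/idP => [[s]|t_ok].
  by rewrite mem_enum inE => s_ok ->.
have /and3P[_ /allP t_pos /eqP t_sum] : is_partition n t by case/andP: t_ok.
have t_size : (size t <= n)%N.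
  rewrite -t_sum; elim: (t) t_pos => //= x u IHu xu_pos.
  have := xu_pos x (mem_head _ _).
  have := IHu (fun y uy => xu_pos y (mem_behead (s := x :: u) uy)); lia.
have t_le x : x \in t -> (x <= n)%N.
  rewrite -t_sum; elim: (t) => //= y u IHu.
  rewrite inE => /orP[/eqP ->|/IHu]; lia.
have s_size : (size [seq inord x : 'I_n.+1 | x <- t] <= n)%N by rewrite size_map.
have f_s : f (Bseq s_size) = t.
  rewrite /f /= -map_comp -[RHS]map_id; apply/eq_in_map => x /t_le x_le /=.
  by rewrite inordK.
by exists (Bseq s_size); rewrite ?mem_enum ?inE -/(f _) f_s.
Qed.

(* Main.v *)
Require Import Defs.
From mathcomp Require Import all_boot all_order all_algebra.
From mathcomp Require Import zify ring.
Import Order.TTheory GRing.Theory Num.Theory.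
Local Open Scope ring_scope.

(** Since [sum_n b_l(n) q^n] is [(q^l; q^l) / (q; q)], multiplying it by Euler's
    expansion of [(q; q)] and expanding [(q^l; q^l)] in the same way shows that
    the sum of [(-1)^j b_l(n - pent j)] over all integers [j] is [rho_l(n)]
    ([pentagonal_b]). Hence the difference between [rho_6(n)] and the sum over
    [|j| <= k] is the sum over the remaining [j]. Grouping [j] with [-j], this
    tail is, up to the sign [(-1)^(k+1)], the alternating sum of
    [a i = b_6(n - pent (k+1+i)) + b_6(n - pent (-(k+1+i)))].

    Adjoining a part 1 shows that [b_6] is nondecreasing ([b_homo]), and the
    pentagonal numbers grow on either side, so [a] is nonnegative and
    nonincreasing. Such an alternating sum is nonnegative, and it is at least
    [a 0 - a 1] ([alternating_sum_ge]). When [pent (k+1) <= n] this difference is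
    positive: [pent (k+2)] exceeds [pent (k+1)] by at least 2, and
    [b_6(x-2) < b_6(x)] for every [x >= 0] ([b_lt]).

    Growth and generating function both come from one recursion: a partition
    with parts at most [m+1] either has no part [m+1] or stays of this kind when
    one such part is removed ([b_uptoS]). Infinite products are avoided by working with polynomials
    modulo a power of the variable; the pentagonal number theorem then follows
    from the finite identity of Shanks ([shanks]). *)

(** * Partitions with bounded parts *)

Definition regular_upto (l m n : nat) (s : seq nat) : bool :=
  [&& is_partition n s, regular l s & all (leq^~ m) s].

Lemma regular_upto_nil (l m n : nat) : regular_upto l m n [::] = (n == 0%N).
Proof. by rewrite /regular_upto /is_partition /= andbT eq_sym. Qed.

Lemma regular_upto_cons (l m n x : nat) (s : seq nat) :
  regular_upto l m n (x :: s) =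
  [&& (x <= m)%N, (0 < x <= n)%N, ~~ (l %| x)%N & regular_upto l x (n - x) s].
Proof.
rewrite /regular_upto /is_partition /= (path_sortedE (rev_trans leq_trans)).
apply/idP/idP.
- case/and3P => /and3P[/andP[le_x sorted_s] /andP[x_gt0 s_gt0] /eqP sum_s].
  case/andP => l_x reg_s /andP[x_le _]; rewrite x_le x_gt0 l_x sorted_s s_gt0 reg_s.
  by apply/and3P; split=> //; lia.
- case/and4P => x_le /andP[x_gt0 x_n] l_x.
  case/and3P => /and3P[sorted_s s_gt0 /eqP sum_s] reg_s le_x.
  rewrite x_le x_gt0 l_x sorted_s s_gt0 reg_s le_x sum_s subnKC // eqxx /=.
  by apply: sub_all le_x => y /leq_trans; apply.
Qed.

(** Recursion on whether the largest allowed part occurs. As [m] and [n]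
    decrease alternately, the recursion is on a strict bound [f] of [m + n]. *)
Fixpoint regular_partitions (l f m n : nat) : seq (seq nat) :=
  if f isn't f'.+1 then [::] else
  if m isn't m'.+1 then (if n == 0%N then [:: [::]] else [::]) else
  regular_partitions l f' m' n ++
  (if (l %| m)%N || (n < m)%N then [::]
   else [seq m :: s | s <- regular_partitions l f' m (n - m)]).

Lemma regular_partitionsS (l f m n : nat) :
  regular_partitions l f.+1 m.+1 n =
  regular_partitions l f m n ++
  (if (l %| m.+1)%N || (n < m.+1)%N then [::]
   else [seq m.+1 :: s | s <- regular_partitions l f m.+1 (n - m.+1)]).
Proof. by []. Qed.

Lemma mem_regular_partitions (l f m n : nat) (s : seq nat) :
  (m + n < f)%N -> (s \in regular_partitions l f m n) = regular_upto l m n s.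
Proof.
elim: f m n s => // f IHf [|m] n s lt_f /=.
  case: s => [|x s]; last first.
    by rewrite regular_upto_cons; case: ifP => _; rewrite ?inE //; case: x.
  by rewrite regular_upto_nil; case: ifP.
rewrite mem_cat IHf; last lia.
case: s => [|x s].
  rewrite !regular_upto_nil; case: ifP => _; first by rewrite orbF.
  by case: mapP => [[]//|_]; rewrite orbF.
rewrite !regular_upto_cons.
have -> : (x :: s \in if (l %| m.+1)%N || (n < m.+1)%N then [::]
     else [seq m.+1 :: s0 | s0 <- regular_partitions l f m.+1 (n - m.+1)]) =
   [&& x == m.+1, ~~ (l %| x)%N, (x <= n)%N & regular_upto l x (n - x) s].
  case: (eqVneq x m.+1) => [->|x_neq] /=.
    case: ifP => [|/norP[-> n_ge]].
      by case/orP=> [->|lt_n] //; rewrite leqNgt lt_n andbF.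
    rewrite leqNgt n_ge /= mem_map; last by move=> ? ? [].
    by apply: IHf; lia.
  case: ifP => // _; apply/mapP => -[t _ [eq_x _]].
  by rewrite eq_x eqxx in x_neq.
case: (eqVneq x m.+1) => [->|x_neq] /=; first by rewrite ltnn leqnn /= andbCA.
by rewrite orbF [(x <= m.+1)%N]leq_eqVlt (negPf x_neq).
Qed.

Lemma regular_partitions_uniq (l f m n : nat) :
  (m + n < f)%N -> uniq (regular_partitions l f m n).
Proof.
elim: f m n => // f IHf [|m] n lt_f /=; first by case: ifP.
rewrite cat_uniq IHf /=; last lia.
case: ifP => [//|/norP[_ n_ge]].
rewrite map_inj_uniq ?IHf ?andbT; [|lia|by move=> ? ? []].
apply/hasPn => _ /mapP[s _ ->] /=.
by rewrite mem_regular_partitions ?regular_upto_cons ?ltnn //; lia.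
Qed.

Definition b_upto (l m : nat) (x : int) : int :=
  if x is Posz n then (size (regular_partitions l (m + n).+1 m n))%:Z else 0.

Lemma b_upto_lt0 (l m : nat) (x : int) : x < 0 -> b_upto l m x = 0.
Proof. by case: x. Qed.

Lemma b_upto_ge0 (l m : nat) (x : int) : 0 <= b_upto l m x.
Proof. by case: x. Qed.

Lemma b_upto0 (l : nat) (x : int) : b_upto l 0 x = (x == 0)%:Z.
Proof. by case: x => [[|n]|n]. Qed.

Lemma b_uptoS (l m : nat) (x : int) :
  b_upto l m.+1 x =
  b_upto l m x + (if (l %| m.+1)%N then 0 else b_upto l m.+1 (x - m.+1%:Z)).
Proof.
case: x => [n|n]; last by rewrite !b_upto_lt0 ?if_same //; lia.
rewrite [LHS]/b_upto addSn regular_partitionsS size_cat PoszD.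
congr (_ + _); case: (l %| m.+1)%N => //; rewrite orFb.
case: ltnP => [n_lt|n_ge]; first by rewrite b_upto_lt0 //; lia.
rewrite size_map subzn // /b_upto; congr Posz.
apply/perm_size/uniq_perm; try by apply: regular_partitions_uniq; lia.
by move=> s; rewrite !mem_regular_partitions //; lia.
Qed.

Lemma b_uptoE (l m : nat) (x : int) : x <= m%:Z -> b l x = b_upto l m x.
Proof.
case: x => // n n_le; rewrite /b /b_upto; congr Posz.
apply: num_regular_unique => [|s]; first exact: regular_partitions_uniq.
rewrite mem_regular_partitions // /regular_upto andbA.
case: (boolP (is_partition n s)) => //= /and3P[_ _ /eqP sum_s].
suff -> : all (leq^~ m) s by rewrite andbT.
apply/allP => x; suff : x \in s -> (x <= sumn s)%N by move=> + /[dup] => /[apply]; lia.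
by elim: (s) => //= y u IHu; rewrite inE => /orP[/eqP ->|/IHu]; lia.
Qed.

(** * Growth of the number of regular partitions *)

(** For one more allowed part [m+1] the increment of [b_upto] at [x] is the sum of
    its increments for [m] at [x] and for [m+1] at [x - (m+1)]; with only the
    part 1 the function is the indicator of [x >= 0]. *)
Lemma b_upto_homo (l m : nat) (x y : int) :
  (1 < l)%N -> (0 < m)%N -> x <= y -> b_upto l m x <= b_upto l m y.
Proof.
move=> l_gt1; case: m => // m _.
have step (z : int) : b_upto l m.+1 (z - 1) <= b_upto l m.+1 z.
  elim: m z => [|m IHm] z.
    by rewrite [leRHS]b_uptoS dvdn1 gtn_eqF // lerDr b_upto_ge0.
  (* Inner induction on a bound of z, with negative z as the base case. *)
  have [k z_lt] : exists k : nat, z < k%:Z by exists (absz z).+1; lia.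
  elim: k z z_lt => [|k IHk] z z_lt.
    by rewrite b_upto_lt0 ?b_upto_ge0 //; lia.
  rewrite [leLHS]b_uptoS [leRHS]b_uptoS lerD //; case: ifP => // _.
  have -> : z - 1 - m.+2%:Z = z - m.+2%:Z - 1 by lia.
  by apply: IHk; lia.
move=> xy; have [d ->] : exists d : nat, y = x + d%:Z by exists (absz (y - x)); lia.
elim: d => [|d IHd]; first by rewrite addr0.
apply: le_trans IHd _; have := step (x + d.+1%:Z).
by have -> : x + d.+1%:Z - 1 = x + d%:Z by lia.
Qed.

(** A step of 2 works uniformly: with parts 1 and 2 only, the increment from
    [x - 2] to [x] counts the partitions of [x] into ones, and by
    [b_upto_homo] a further part never lowers it. A step of 1 would fail
    between 0 and 1. *)
Lemma b_upto_lt (l m : nat) (x : int) :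
  (2 < l)%N -> (1 < m)%N -> 0 <= x -> b_upto l m (x - 2) < b_upto l m x.
Proof.
move=> l_gt2 + x_ge0; case: m => [|[|m]] // _.
elim: m => [|m IHm].
  (* b_upto l 1 x is at least b_upto l 1 0, the number of empty partitions. *)
  rewrite [ltRHS]b_uptoS gtnNdvd // -[ltLHS]add0r ltrD2r.
  apply: (lt_le_trans (y := b_upto l 1 0)); last by apply: b_upto_homo; lia.
  by rewrite b_uptoS dvdn1 gtn_eqF //; lia.
rewrite b_uptoS [ltRHS]b_uptoS ltr_leD //; case: ifP => // _.
by apply: b_upto_homo; lia.
Qed.

Lemma b_ge0 (l : nat) (x : int) : 0 <= b l x.
Proof. by case: x. Qed.

Lemma b_homo (l : nat) (x y : int) : (1 < l)%N -> x <= y -> b l x <= b l y.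
Proof.
move=> l_gt1 xy; rewrite !(b_uptoE _ (absz y).+1); try lia.
exact: b_upto_homo.
Qed.

Lemma b_lt (l : nat) (x y : int) :
  (2 < l)%N -> 0 <= y -> x <= y - 2 -> b l x < b l y.
Proof.
move=> l_gt2 y_ge0 xy; apply: le_lt_trans (b_homo l _ _ _ xy) _; first lia.
by rewrite !(b_uptoE _ (absz y).+2); try lia; apply: b_upto_lt.
Qed.

(** * Sums over symmetric ranges *)

Lemma big_symrangeS (V : nmodType) (k : nat) (F : int -> V) :
  \sum_(j <- symrange k.+1) F j =
  \sum_(j <- symrange k) F j + (F k.+1%:Z + F (- k.+1%:Z)).
Proof.
rewrite (perm_big (k.+1%:Z :: - k.+1%:Z :: symrange k)).
  by rewrite 2!big_cons [RHS]addrC -addrA.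
apply: uniq_perm; first exact: symrange_uniq.
  rewrite 2!cons_uniq symrange_uniq in_cons !mem_symrange; lia.
by move=> j; rewrite mem_symrange 2!in_cons mem_symrange; lia.
Qed.

Lemma big_symrange0 (V : nmodType) (F : int -> V) :
  \sum_(j <- symrange 0) F j = F 0.
Proof. by rewrite /symrange /= big_seq1. Qed.

Lemma big_symrangeD (V : nmodType) (k d : nat) (F : int -> V) :
  \sum_(j <- symrange (k + d)) F j =
  \sum_(j <- symrange k) F j +
  \sum_(i < d) (F (k + i).+1%:Z + F (- (k + i).+1%:Z)).
Proof.
elim: d => [|d IHd]; first by rewrite addn0 big_ord0 addr0.
by rewrite addnS big_symrangeS IHd big_ord_recr [RHS]addrA.
Qed.

(** * The pentagonal number theorem *)

Lemma pent_ge0 (j : int) : 0 <= pent j.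
Proof. have := mul2_pent j; nia. Qed.

(** The exponents in the form in which they occur in Shanks's identity. *)
Lemma pent_nat (m : nat) : pent m%:Z = (m * m.-1 + 'C(m.+1, 2))%N%:Z.
Proof.
have := mul2_pent m; have := mul_bin_diag m.+1 1; rewrite bin1.
by case: m => [|m] /=; nia.
Qed.

Lemma pent_opp_nat (m : nat) : pent (- m%:Z) = (m * m + 'C(m.+1, 2))%N%:Z.
Proof.
have := mul2_pent (- m%:Z); have := mul_bin_diag m.+1 1; rewrite bin1 /=; nia.
Qed.

Lemma pent_natS (m : nat) : pent m.+1%:Z = pent m%:Z + (3 * m + 1)%N%:Z.
Proof. have := mul2_pent m.+1; have := mul2_pent m; lia. Qed.

Lemma pent_opp_natS (m : nat) :
  pent (- m.+1%:Z) = pent (- m%:Z) + (3 * m + 2)%N%:Z.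
Proof. have := mul2_pent (- m.+1%:Z); have := mul2_pent (- m%:Z); lia. Qed.

Lemma absz_le_pent (j : int) : `|j| <= pent j.
Proof. have := mul2_pent j; nia. Qed.

Definition pentagonal_term (R : comNzRingType) (x : R) (j : int) : R :=
  (-1) ^+ `|j|%N * x ^+ `|pent j|%N.

(** The [r]-th term [(-1)^r (x; x)_n / (x; x)_r x^(rn + r(r+1)/2)] of Shanks's sum. *)
Definition shanks_term (R : comNzRingType) (x : R) (n r : nat) : R :=
  (-1) ^+ r * \prod_(r.+1 <= i < n.+1) (1 - x ^+ i) * x ^+ (r * n + 'C(r.+1, 2)).

(** The telescoping certificate for the step from [n] to [n+1]. Starting the
    product at [r] makes it vanish at [r = 0], through the factor [1 - x^0]. *)
Definition shanks_cert (R : comNzRingType) (x : R) (n r : nat) : R :=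
  (-1) ^+ r * \prod_(r <= i < n.+1) (1 - x ^+ i) * x ^+ (r * n + 'C(r.+1, 2)).

Lemma shanks_term_telescope (R : comNzRingType) (x : R) (n r : nat) :
  (r <= n)%N ->
  shanks_term R x n.+1 r - shanks_term R x n r =
  shanks_cert R x n r.+1 - shanks_cert R x n r.
Proof.
move=> r_le; rewrite /shanks_term /shanks_cert.
rewrite [\prod_(r.+1 <= i < n.+2) _]big_nat_recr; last lia.
rewrite [\prod_(r <= i < n.+1) _]big_ltn; last lia.
have -> : 'C(r.+2, 2) = ('C(r.+1, 2) + r.+1)%N by rewrite binS bin1.
move: 'C(r.+1, 2) (\prod_(r.+1 <= i < n.+1) _) => e p.
have -> : (r.+1 * n + (e + r.+1) = r * n + e + n + r.+1)%N by lia.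
have -> : (r * n.+1 + e = r * n + e + r)%N by lia.
rewrite /= !exprD !exprS; ring.
Qed.

(** Shanks's finite form of the pentagonal number theorem. From [n] to [n+1],
    the terms [r <= n] change in total by the certificate at [n+1], which is the
    pentagonal term of index [n+1]; the new term [r = n+1] is that of index
    [-(n+1)]. *)
Lemma shanks (R : comNzRingType) (x : R) (n : nat) :
  \sum_(0 <= r < n.+1) shanks_term R x n r =
  \sum_(j <- symrange n) pentagonal_term R x j.
Proof.
elim: n => [|n IHn].
  rewrite big_symrange0 big_nat1 /shanks_term /pentagonal_term.
  by rewrite big_geq // !expr0 !mul1r.
rewrite big_symrangeS -IHn big_nat_recr //=.
have -> : \sum_(0 <= r < n.+1) shanks_term R x n.+1 r =
    \sum_(0 <= r < n.+1) shanks_term R x n r + shanks_cert R x n n.+1.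
  apply/eqP; rewrite addrC -subr_eq -sumrB; apply/eqP.
  under eq_big_nat => r r_lt do rewrite shanks_term_telescope //.
  rewrite telescope_sumr // {2}/shanks_cert big_ltn // expr0 subrr.
  by rewrite mul0r mulr0 mul0r subr0.
rewrite -addrA; congr (_ + (_ + _)).
  by rewrite /shanks_cert /pentagonal_term pent_nat big_geq // mulr1.
by rewrite /shanks_term /pentagonal_term pent_opp_nat big_geq // mulr1 abszN.
Qed.

(** * Power series modulo a power of the variable *)

Definition eq_upto (N : nat) (p q : {poly int}) : Prop :=
  forall i, (i < N)%N -> p`_i = q`_i.

Lemma eq_upto_trans (N : nat) (p q r : {poly int}) :
  eq_upto N p q -> eq_upto N q r -> eq_upto N p r.
Proof. by move=> pq qr i i_lt; rewrite pq ?qr. Qed.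

Lemma eq_uptoMl (N : nat) (p q r : {poly int}) :
  eq_upto N p q -> eq_upto N (r * p) (r * q).
Proof.
move=> pq i i_lt; rewrite !coefM; apply: eq_bigr => j _.
by rewrite pq //; lia.
Qed.

Lemma eq_uptoMr (N : nat) (p q r : {poly int}) :
  eq_upto N p q -> eq_upto N (p * r) (q * r).
Proof. by rewrite ![_ * r]mulrC; apply: eq_uptoMl. Qed.

Lemma coef_signM (p : {poly int}) (m i : nat) :
  ((-1) ^+ m * p)`_i = (-1) ^+ m * p`_i.
Proof.
by rewrite -signr_odd -[(-1) ^+ m]signr_odd !mulr_sign; case: odd; rewrite ?coefN.
Qed.

(** In Shanks's sum the term [r = 0] is the full product, and every other term is
    divisible by the power [m+1] of the variable. The variable is replaced by
    its [l]-th power so that the result covers both sides of [pentagonal_b]. *)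
Lemma euler_pentagonal (l N m : nat) :
  (0 < l)%N -> (N <= m.+1)%N ->
  eq_upto N (\prod_(1 <= i < m.+1) (1 - 'X^l ^+ i))
    (\sum_(j <- symrange m) pentagonal_term {poly int} 'X^l j).
Proof.
move=> l_gt0 N_le i i_lt; rewrite -shanks [\sum_(0 <= r < _) _]big_ltn // coefD coef_sum.
rewrite [\sum_(1 <= r < _) _]big1_seq ?addr0; last first.
  move=> r /andP[_]; rewrite mem_index_iota => /andP[r_gt0 r_lt].
  rewrite /shanks_term -exprM coefMXn.
  have bin_pos : (0 < 'C(r.+1, 2))%N by rewrite bin_gt0.
  by rewrite ifT // (leq_trans _ (leq_pmull _ l_gt0)) //; nia.
by rewrite /shanks_term mul0n !expr0 mul1r mulr1.
Qed.

Lemma sign_absz (j : int) : (-1) ^ j = (-1) ^+ `|j|%N :> int.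
Proof. by case: j. Qed.

Definition b_upto_poly (l N m : nat) : {poly int} := \poly_(i < N) b_upto l m i.

Lemma b_upto_polyS (l N m : nat) :
  eq_upto N ((if (l %| m.+1)%N then 1 else 1 - 'X^(m.+1)) * b_upto_poly l N m.+1)
    (b_upto_poly l N m).
Proof.
move=> i i_lt; rewrite [RHS]coef_poly i_lt.
case: ifP => l_m; first by rewrite mul1r coef_poly i_lt b_uptoS l_m addr0.
rewrite mulrBl mul1r coefB coefXnM !coef_poly i_lt b_uptoS l_m.
case: ltnP => i_m; first by rewrite [b_upto l _ (_ - _)]b_upto_lt0 ?subr0 ?addr0 //; lia.
by rewrite subzn // ifT ?addrK //; lia.
Qed.

(** Only the factors [1 - X^i] with [i] not a multiple of [l] are cancelled by the
    generating function. *)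
Lemma b_upto_poly_prod (l N m : nat) :
  eq_upto N (\prod_(1 <= i < m.+1) (1 - 'X^i) * b_upto_poly l N m)
    (\prod_(1 <= i < m.+1 | (l %| i)%N) (1 - 'X^i)).
Proof.
elim: m => [|m IHm].
  rewrite !big_geq // mul1r => i i_lt; rewrite coef_poly i_lt b_upto0 coef1.
  by case: i {i_lt}.
rewrite big_nat_recr // [X in eq_upto _ _ X]big_mkcond.
rewrite [X in eq_upto _ _ X]big_nat_recr //= -big_mkcond.
have := b_upto_polyS l N m; case: ifP => _ recb.
  rewrite mulrAC; apply: eq_uptoMr; apply: eq_upto_trans IHm.
  by apply: eq_uptoMl; rewrite mul1r in recb.
by rewrite mulr1 -mulrA; apply: eq_upto_trans IHm; apply: eq_uptoMl.
Qed.

Lemma prod_multiples (l m : nat) (F : nat -> {poly int}) :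
  (0 < l)%N ->
  \prod_(1 <= i < m.+1 | (l %| i)%N) F i = \prod_(1 <= i < (m %/ l).+1) F (l * i)%N.
Proof.
move=> l_gt0; elim: m => [|m IHm]; first by rewrite div0n !big_geq.
rewrite big_mkcond big_nat_recr //= -big_mkcond IHm divnS //.
case: ifP => l_m; last by rewrite mulr1.
rewrite add1n [RHS]big_nat_recr //=; congr (_ * F _).
by rewrite -[LHS](divnK l_m) divnS // l_m mulnC.
Qed.

Lemma rho_sum (l n m : nat) :
  (0 < l)%N -> (n <= m)%N ->
  \sum_(j <- symrange m) (if n%:Z == l%:Z * pent j then (-1) ^ j else 0) = rho l n.
Proof.
move=> l_gt0 n_le; rewrite -big_mkcond -big_filter.
have s_uniq := filter_uniq (fun j => n%:Z == l%:Z * pent j) (symrange_uniq m).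
case def_s: [seq _ <- _ | _] s_uniq => [|i s].
  move=> _; rewrite big_nil rho_eq0 // => i n_eq.
  suff : i \in [::] by [].
  rewrite -def_s mem_filter mem_symrange n_eq eqxx /=.
  have := absz_le_pent i; nia.
have s_eq j : j \in i :: s -> n%:Z = l%:Z * pent j.
  by rewrite -def_s mem_filter => /andP[/eqP].
case: s s_eq {def_s} => [|j s] s_eq.
  by rewrite big_seq1 (rho_pent l_gt0 (s_eq i (mem_head _ _))).
have n_i := s_eq i (mem_head _ _).
have := s_eq j; rewrite !inE eqxx orbT => /(_ isT).
rewrite {1}n_i => /(mulfI (_ : l%:Z != 0)) => /(_ ltac:(lia)) /pent_inj ->.
by rewrite /= inE eqxx.
Qed.

(** Coefficients of [(X; X) * G = (X^l; X^l)], both products being expanded by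
    [euler_pentagonal]. *)
Lemma pentagonal_b (l n m : nat) :
  (0 < l)%N -> (n <= m)%N ->
  \sum_(j <- symrange (l * m)) (-1) ^ j * b l (n%:Z - pent j) = rho l n.
Proof.
move=> l_gt0 n_le; have n_le_lm : (n <= l * m)%N by nia.
rewrite -(rho_sum l n m) //.
pose G := b_upto_poly l n.+1 (l * m).
transitivity (((\sum_(j <- symrange (l * m)) pentagonal_term {poly int} 'X j) * G)`_n).
  rewrite mulr_suml coef_sum; apply: eq_bigr => j _.
  rewrite /pentagonal_term -mulrA coef_signM -sign_absz coefXnM coef_poly.
  have := pent_ge0 j; case: (pent j) => // e _ /=; congr (_ * _).
  case: ltnP => e_n; first by rewrite (b_uptoE _ 0) ?b_upto_lt0 //; lia.
  by rewrite ifT ?subzn ?(b_uptoE _ (l * m)) //; lia.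
(* The coefficient in the expansion of the product over multiples of l. *)
transitivity ((\sum_(j <- symrange m) pentagonal_term {poly int} 'X^l j)`_n); last first.
  rewrite coef_sum; apply: eq_bigr => j _.
  rewrite /pentagonal_term coef_signM -sign_absz -exprM coefXn.
  have -> : (n%:Z == l%:Z * pent j) = (n == (l * `|pent j|)%N) by have := pent_ge0 j; lia.
  by case: eqP; rewrite ?mulr1 ?mulr0.
have := euler_pentagonal 1 n.+1 (l * m) isT n_le_lm.
rewrite expr1 => euler1.
rewrite -(eq_uptoMr _ _ _ G euler1) // (b_upto_poly_prod l) //.
rewrite prod_multiples // mulKn //.
under eq_bigr => i _ do rewrite exprM.
exact: (euler_pentagonal l n.+1).
Qed.

(** * Alternating sums of decreasing sequences *)

Lemma alternating_sum_recl (a : nat -> int) (d : nat) :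
  \sum_(i < d.+1) (-1) ^+ i * a i = a 0%N - \sum_(i < d) (-1) ^+ i * a i.+1.
Proof.
rewrite big_ord_recl expr0 mul1r -sumrN; congr (_ + _).
by apply: eq_bigr => i _; rewrite exprS mulN1r mulNr.
Qed.

Lemma alternating_sum_bounds (a : nat -> int) (d : nat) :
  (forall i, 0 <= a i) -> (forall i, a i.+1 <= a i) ->
  0 <= \sum_(i < d) (-1) ^+ i * a i <= a 0%N.
Proof.
elim: d a => [|d IHd] a a_ge0 a_dec; first by rewrite big_ord0 lexx a_ge0.
have := IHd (fun i => a i.+1) (fun i => a_ge0 _) (fun i => a_dec _).
rewrite alternating_sum_recl; have := a_dec 0%N; lia.
Qed.

Lemma alternating_sum_ge (a : nat -> int) (d : nat) :
  (forall i, 0 <= a i) -> (forall i, a i.+1 <= a i) ->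
  a 0%N - a 1%N <= \sum_(i < d.+1) (-1) ^+ i * a i.
Proof.
move=> a_ge0 a_dec; rewrite alternating_sum_recl lerD2l lerN2.
have := alternating_sum_bounds (fun i => a i.+1) d (fun i => a_ge0 _) (fun i => a_dec _).
by case/andP.
Qed.

(** * The truncated theorem *)

Theorem theorem1p3 (n k : nat) (k_gt0 : (0 < k)%N) :
  let D : int :=
    (-1) ^ (k%:Z - 1) *
      (rho 6 n - \sum_(j <- symrange k) (-1) ^ j * b 6 (n%:Z - pent j)) in
  0 <= D /\ (pent (k%:Z + 1) <= n%:Z -> 0 < D).
Proof.
move=> D.
pose a i := b 6 (n%:Z - pent (k + i).+1%:Z) + b 6 (n%:Z - pent (- (k + i).+1%:Z)).
have a_ge0 i : 0 <= a i by rewrite addr_ge0 ?b_ge0.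
have a_dec i : a i.+1 <= a i.
  rewrite lerD // b_homo // lerD2l lerN2 addnS.
    by rewrite [leRHS]pent_natS lerDl.
  by rewrite [leRHS]pent_opp_natS lerDl.
(* The sum over |j| <= 6 (n + k) is complete by pentagonal_b, and 6 (n + k) > k. *)
have [d def_d] : exists d, (6 * (n + k) = k + d.+1)%N.
  by exists (6 * (n + k) - k.+1)%N; lia.
have -> : D = \sum_(i < d.+1) (-1) ^+ i * a i.
  rewrite /D -(pentagonal_b 6 n (n + k)) ?leq_addr // def_d big_symrangeD.
  rewrite addrAC subrr add0r mulr_sumr; apply: eq_bigr => i _.
  have -> : k%:Z - 1 = k.-1%:Z by lia.
  rewrite !sign_absz abszN /= -mulrDr mulrA -exprD.
  have -> : (k.-1 + (k + i).+1 = 2 * k + i)%N by lia.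
  by rewrite exprD exprM sqrrN !expr1n mul1r.
have a_bounds := alternating_sum_bounds a d.+1 a_ge0 a_dec.
split=> [|n_ge]; first by case/andP: a_bounds.
apply: lt_le_trans (alternating_sum_ge a d a_ge0 a_dec).
rewrite subr_gt0 ltr_leD //.
  apply: b_lt => //; first by rewrite addn0; have -> : k.+1%:Z = k%:Z + 1; lia.
  by rewrite addn0 addn1 [pent k.+2]pent_natS; lia.
by apply: b_homo => //; rewrite addn0 addn1 [pent (- k.+2%:Z)]pent_opp_natS; lia.
Qed.
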